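(* For every integer $n\ge 6$, $$\hat{r}_c(2K_2,C_n)\le\begin{cases}\frac{3n+4}{2}, & n\text{ even},\\[2pt] \frac{3n+7}{2}, & n\text{ odd}.\end{cases}$$
   Context: All graphs are finite and simple. The size $e(F)$ of a graph $F$ is its number of edges. For graphs $F,G,H$, write $F\to(G,H)$ if for every coloring of the edges of $F$ with the colors red and blue, $F$ contains either a subgraph isomorphic to $G$ all of whose edges are red, or a subgraph isomorphic to $H$ all of whose edges are blue (subgraphs are not necessarily induced). The connected size Ramsey number $\hat{r}_c(G,H)$ is the smallest possible size of a connected graph $F$ with $F\to(G,H)$. $C_n$ denotes the cycle on $n$ vertices, and $2K_2$ is the disjoint union of two edges (a matching of size 2). *)

(* Defs.v *)
From HB Require Import structures.
From mathcomp Require Import all_boot.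

Set Implicit Arguments.
Unset Strict Implicit.
Unset Printing Implicit Defensive.

Record sgraph := SGraph {
  vertex :> finType;
  adj : rel vertex;
  adj_sym : symmetric adj;
  adj_irrefl : irreflexive adj
}.

Definition edges (F : sgraph) : {set {set F}} :=
  [set [set p.1; p.2] | p : F * F & adj p.1 p.2].

Definition gsize (F : sgraph) : nat := #|edges F|.

Definition connected (F : sgraph) : Prop :=
  0 < #|F| /\ forall x y : F, connect (@adj F) x y.

(* (W, D) is the subgraph of F with vertex set W and edge set D; it need not
   be induced. *)
Definition is_subgraph (F : sgraph) (W : {set F}) (D : {set {set F}}) : Prop :=
  D \subset edges F /\ (forall e, e \in D -> e \subset W).

Definition isomorphic_to (G F : sgraph) (W : {set F}) (D : {set {set F}}) :
    Prop :=
  exists f : G -> F,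
    [/\ injective f, f @: [set: G] = W
      & forall x y : G, adj x y = ([set f x; f y] \in D)].

Inductive color := Red | Blue.

(* A coloring is defined on all vertex sets of F; only its values on edges F
   are ever used, since D is contained in edges F. *)
Definition has_mono_copy (F : sgraph) (c : {set F} -> color) (k : color)
    (G : sgraph) : Prop :=
  exists (W : {set F}) (D : {set {set F}}),
    [/\ is_subgraph W D, isomorphic_to G W D & forall e, e \in D -> c e = k].

Definition arrows (F G H : sgraph) : Prop :=
  forall c : {set F} -> color, has_mono_copy c Red G \/ has_mono_copy c Blue H.

(* r is the connected size Ramsey number of (G, H). As a relation, this avoids
   a default value should no connected graph arrow (G, H). *)
Definition is_conn_size_ramsey (G H : sgraph) (r : nat) : Prop :=
  (exists F : sgraph, [/\ connected F, arrows F G H & gsize F = r]) /\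
  (forall F : sgraph, connected F -> arrows F G H -> r <= gsize F).

Lemma is_conn_size_ramsey_uniq (G H : sgraph) (r s : nat) :
  is_conn_size_ramsey G H r -> is_conn_size_ramsey G H s -> r = s.
Proof.
move=> [[F [cF aF <-]] minr] [[F' [cF' aF' <-]] mins].
by apply/eqP; rewrite eqn_leq minr ?mins.
Qed.

Definition complete_rel (n : nat) : rel 'I_n := fun i j => i != j.

Lemma complete_rel_sym n : symmetric (@complete_rel n).
Proof. by move=> i j; rewrite /complete_rel eq_sym. Qed.

Lemma complete_rel_irrefl n : irreflexive (@complete_rel n).
Proof. by move=> i; rewrite /complete_rel eqxx. Qed.

Definition complete_graph (n : nat) : sgraph :=
  SGraph (@complete_rel_sym n) (@complete_rel_irrefl n).

Definition copies_rel (m : nat) (G : sgraph) : rel ('I_m * G)%type :=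
  fun x y => (x.1 == y.1) && adj x.2 y.2.

Lemma copies_rel_sym m G : symmetric (@copies_rel m G).
Proof. by move=> x y; rewrite /copies_rel eq_sym adj_sym. Qed.

Lemma copies_rel_irrefl m G : irreflexive (@copies_rel m G).
Proof. by move=> x; rewrite /copies_rel adj_irrefl andbF. Qed.

(* m G, the disjoint union of m copies of G. *)
Definition copies (m : nat) (G : sgraph) : sgraph :=
  SGraph (@copies_rel_sym m G) (@copies_rel_irrefl m G).

(* ordS is the successor modulo n; the conjunct i != j only matters for n = 1,
   and this is the cycle C_n for n >= 3. *)
Definition cycle_rel (n : nat) : rel 'I_n :=
  fun i j => (i != j) && ((j == ordS i) || (i == ordS j)).

Lemma cycle_rel_sym n : symmetric (@cycle_rel n).
Proof. by move=> i j; rewrite /cycle_rel eq_sym orbC. Qed.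

Lemma cycle_rel_irrefl n : irreflexive (@cycle_rel n).
Proof. by move=> i; rewrite /cycle_rel eqxx. Qed.

Definition cycle_graph (n : nat) : sgraph :=
  SGraph (@cycle_rel_sym n) (@cycle_rel_irrefl n).

(* Main.v *)
(** The graph is a ladder with rows [false], [true] and columns [0], ...,
    [k.+1], closed up by one or two edges between its end columns. It is
    triangle-free, so if there is no red [2K_2], then all red edges share a
    vertex [v], and it suffices that deleting any vertex [v] leaves a cycle
    [C_n]. If [n = 2k+3], the end columns are joined by two edges such that the
    walk that zigzags through all columns, but visits only one vertex in the
    column of [v], closes up. If [n = 2k+2], there is only one edge, and its
    parity is such that the zigzag closes up after skipping a vertex in two
    columns; one of them is the column of [v] and the other is an end column.
    This fails for the two ends of the closing edge, but they are avoided by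
    the boundary of the ladder without their column. *)
Require Import Defs.
From mathcomp Require Import all_boot zify.
From Stdlib Require Import Classical.

Set Implicit Arguments.
Unset Strict Implicit.
Unset Printing Implicit Defensive.

(** * Existence of the connected size Ramsey number *)

(** Strong induction with excluded middle, since [P] will quantify over all graphs and is not
    decidable. *)
Lemma exists_least (P : nat -> Prop) (m : nat) :
  P m -> exists r, [/\ P r, forall s, P s -> r <= s & r <= m].
Proof.
elim/ltn_ind: m => m IH Pm.
have [[s [Ps lt_sm]]|nP] := classic (exists s, P s /\ s < m).
  have [r [Pr minr le_rs]] := IH s lt_sm Ps.
  by exists r; split=> //; apply: leq_trans le_rs (ltnW lt_sm).
exists m; split=> // s Ps; rewrite leqNgt; apply/negP => lt_sm.
by apply: nP; exists s.
Qed.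

Lemma conn_size_ramsey_le (G H F : sgraph) :
  connected F -> arrows F G H ->
  exists r, is_conn_size_ramsey G H r /\ r <= gsize F.
Proof.
move=> cF aF.
pose P m := exists F' : sgraph, [/\ connected F', arrows F' G H & gsize F' = m].
have [|r [Pr minr le_rF]] := @exists_least P (gsize F); first by exists F.
exists r; split=> //; split=> // F' cF' aF'.
by apply: minr; exists F'.
Qed.

(** * Monochromatic copies of the matching and of the cycle *)

Lemma set2_eq (T : finType) (x y a b : T) :
  [set x; y] = [set a; b] -> x = a /\ y = b \/ x = b /\ y = a.
Proof.
move=> E.
have: x \in [set a; b] by rewrite -E set21.
have: y \in [set a; b] by rewrite -E set22.
have: a \in [set x; y] by rewrite E set21.
have: b \in [set x; y] by rewrite E set22.
by do 4!case/set2P=> ?; subst; auto.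
Qed.

(** The copy has only the images of the edges of [G] as its edge set, so injectivity gives the
    equivalence in [isomorphic_to] although the image need not be induced. *)
Lemma mono_copy_of_embedding (F G : sgraph) (c : {set F} -> color) (k : color)
    (f : G -> F) :
  injective f ->
  (forall x y, adj x y -> adj (f x) (f y) /\ c [set f x; f y] = k) ->
  has_mono_copy c k G.
Proof.
move=> injf homf.
pose D := [set [set f p.1; f p.2] | p : G * G & adj p.1 p.2].
have DP e : e \in D -> exists x y, adj x y /\ e = [set f x; f y].
  by case/imsetP=> -[x y]; rewrite inE /= => xy ->; exists x, y.
exists (f @: [set: G]), D; split.
- split=> [|e /DP[x [y [xy ->]]]]; last first.
    by apply/subsetP=> z /set2P[]->; rewrite imset_f.
  apply/subsetP=> e /DP[x [y [xy ->]]]; apply/imsetP; exists (f x, f y) => //.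
  by rewrite inE; have [] := homf x y xy.
- exists f; split=> // x y; apply/idP/idP=> [xy|/DP[a [b [ab]]]].
    by apply/imsetP; exists (x, y); rewrite ?inE.
  by case/set2_eq=> -[/injf-> /injf->] //; rewrite adj_sym.
- by move=> e /DP[x [y [xy ->]]]; have [] := homf x y xy.
Qed.

Lemma mono_copy_2K2 (F : sgraph) (c : {set F} -> color) (k : color)
    (x y z w : F) :
  adj x y -> adj z w -> c [set x; y] = k -> c [set z; w] = k ->
  x != z -> x != w -> y != z -> y != w ->
  has_mono_copy c k (copies 2 (complete_graph 2)).
Proof.
move=> xy zw cxy czw nxz nxw nyz nyw.
have nxy : x != y by apply: contraTneq xy => ->; rewrite adj_irrefl.
have nzw : z != w by apply: contraTneq zw => ->; rewrite adj_irrefl.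
pose f (p : copies 2 (complete_graph 2)) : F :=
  if p.1 == ord0 :> 'I_2 then (if p.2 == ord0 :> 'I_2 then x else y)
  else (if p.2 == ord0 :> 'I_2 then z else w).
have I2 (i : 'I_2) : i = ord0 \/ i = lift ord0 ord0.
  by case: i => -[|[|m]] lt_m //; [left|right]; apply: val_inj.
apply: (@mono_copy_of_embedding _ _ _ _ f).
  move=> [i j] [i' j'].
  by case: (I2 i) (I2 j) (I2 i') (I2 j')=> -> [] -> [] -> [] -> //;
    rewrite /f /= => E; move: nxz nxw nyz nyw nxy nzw; rewrite E eqxx.
move=> [i j] [i' j'].
by case: (I2 i) (I2 j) (I2 i') (I2 j')=> -> [] -> [] -> [] -> //= _;
  rewrite /f /= 1?[adj y x]adj_sym 1?[adj w z]adj_sym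
    1?[[set y; x]]setUC 1?[[set w; z]]setUC.
Qed.

Lemma cycle_nth_ordS (T : Type) (e : rel T) (x0 : T) (s : seq T) (i : nat) :
  cycle e s -> i < size s -> e (nth x0 s i) (nth x0 s (i.+1 %% size s)).
Proof.
case: s => // x p /(pathP x0) /= es lt_i.
have := es i; rewrite size_rcons => /(_ lt_i).
rewrite -rcons_cons !nth_rcons /= lt_i.
have [lt_ip|] := ltnP i (size p); first by rewrite modn_small.
move=> le_pi; have -> : i = size p by lia.
by rewrite eqxx modnn.
Qed.

Lemma mono_copy_cycle (F : sgraph) (c : {set F} -> color) (k : color)
    (s : seq F) :
  0 < size s -> uniq s -> cycle (@adj F) s ->
  (forall x y, x \in s -> y \in s -> adj x y -> c [set x; y] = k) ->
  has_mono_copy c k (cycle_graph (size s)).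
Proof.
case: s => // x0 p; set s := x0 :: p => _ us cs cols.
pose f (i : cycle_graph (size s)) : F := nth x0 s (nat_of_ord i).
apply: (@mono_copy_of_embedding _ _ _ _ f).
  by move=> i j /eqP; rewrite nth_uniq ?ltn_ord // => /eqP/val_inj.
have step (i j : 'I_(size s)) : j = ordS i -> adj (nth x0 s i) (nth x0 s j).
  by move=> ->; apply: cycle_nth_ordS.
move=> i j; rewrite [adj _ _]/(cycle_rel i j) => /andP[_ ij].
have aij : adj (nth x0 s i) (nth x0 s j).
  by case/orP: ij => /eqP/step; rewrite // adj_sym.
by split=> //; apply: cols aij; apply: mem_nth; apply: ltn_ord.
Qed.

(** * Reduction to cycles avoiding a vertex *)

Definition red (k : color) : bool := if k is Red then true else false.

(** Pairwise meeting red edges form a star or a triangle, and [tri] excludes the triangle. A cycle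
    that avoids the center of the star is entirely blue. *)
Lemma arrows_2K2_cycle (F : sgraph) (n : nat) :
  0 < #|F| -> 0 < n ->
  (forall x y z : F, adj x y -> adj y z -> ~~ adj x z) ->
  (forall v : F, exists s : seq F,
     [/\ size s = n, uniq s, cycle (@adj F) s & v \notin s]) ->
  arrows F (copies 2 (complete_graph 2)) (cycle_graph n).
Proof.
move=> F_gt0 n_gt0 tri cyc c.
pose rede x y := adj x y && red (c [set x; y]).
have redC x y : rede x y = rede y x by rewrite /rede adj_sym setUC.
have redP x y : rede x y -> adj x y /\ c [set x; y] = Red.
  by case/andP=> ->; case: (c _).
have [[x [y [z [w [xy zw]]]]]|noM] := classic (exists x y z w,
    [/\ rede x y, rede z w & [&& x != z, x != w, y != z & y != w]]).
  case/and4P=> *; left; have [axy cxy] := redP _ _ xy.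
  by have [azw czw] := redP _ _ zw; apply: (mono_copy_2K2 axy azw).
have meet x y z w : rede x y -> rede z w ->
    [|| x == z, x == w, y == z | y == w].
  move=> xy zw; apply: contra_notT noM; rewrite !negb_or => ?.
  by exists x, y, z, w.
suff [v starv] : exists v, forall x y, rede x y -> (x == v) || (y == v).
  have [s [sz us cs vs]] := cyc v.
  right; rewrite -sz; apply: mono_copy_cycle; rewrite ?sz // => x y xs ys xy.
  have := starv x y; rewrite /rede xy /=; case: (c _) => //= /(_ isT).
  by case/orP=> /eqP Ev; rewrite -Ev ?xs ?ys in vs.
have [v0 _] := card_gt0P F_gt0.
(* Without red edges, any vertex serves as the center. *)
have [[x [y xy]]|no] := classic (exists x y, rede x y); last first.
  by exists v0 => x y xy; case: no; exists x, y.
apply: NNPP => noS.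
(* As [a] is not a center, some red edge misses [a]; it meets the edge [ab], hence contains [b]. *)
have third a b : rede a b -> exists2 u, rede b u & u != a.
  move=> ab; apply: NNPP => no; case: noS; exists a => z w zw.
  have := meet _ _ _ _ ab zw; rewrite ![a == _]eq_sym.
  case: eqP => //= za; case: eqP => //= wa /orP[] /eqP bE; subst b.
    by case: no; exists w => //; apply/eqP.
  by case: no; exists z; [rewrite redC|apply/eqP].
have [u yu ux] := third x y xy.
have [w xw wy] := third y x (etrans (redC y x) xy).
(* These two edges can meet only in [u = w], which closes a triangle on [x], [y], [u]. *)
have := meet _ _ _ _ yu xw; rewrite (negPf ux) eq_sym [y == w]eq_sym (negPf wy).
case: eqP => [xE|_ /= /eqP uw]; first by case/redP: xy; rewrite xE adj_irrefl.
subst w; case/redP: xy => axy _; case/redP: yu => ayu _; case/redP: xw => axu _.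
by case/negP: (tri _ _ _ axy ayu).
Qed.

(** * The closed ladder *)

(* A vertex is a pair of a column and a row. The closing edges join [(0, b)] to
   [(k.+1, b (+) d)], where [b = false] is allowed only if [both] holds. *)
Definition half_ladder (k : nat) (d both : bool) : rel (nat * bool) :=
  fun x y =>
  [|| [&& x.1 == y.1, ~~ x.2 & y.2],
      (x.1.+1 == y.1) && (x.2 == y.2)
    | [&& x.1 == 0, y.1 == k.+1, y.2 == x.2 (+) d & both || x.2]].

Definition ladder_rel (k : nat) (d both : bool) : rel (nat * bool) :=
  fun x y => half_ladder k d both x y || half_ladder k d both y x.

Lemma ladder_sym k d both : symmetric (ladder_rel k d both).
Proof. by move=> x y; rewrite /ladder_rel orbC. Qed.

Lemma ladder_rung k d both i b : ladder_rel k d both (i, b) (i, ~~ b).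
Proof. by rewrite /ladder_rel /half_ladder /= eqxx; case: b; rewrite ?orbT. Qed.

Lemma ladder_rail k d both i b : ladder_rel k d both (i, b) (i.+1, b).
Proof. by rewrite /ladder_rel /half_ladder /= !eqxx ?orbT. Qed.

Lemma ladder_irrefl k d both : irreflexive (ladder_rel k d both).
Proof.
move=> [i b]; apply/negP; rewrite /ladder_rel /half_ladder /=; case: b; lia.
Qed.

(** There are at least four columns in cyclic order, so a triangle would lie in two neighboring
    columns, whose edges form at most a 4-cycle. *)
Lemma ladder_triangle_free k d both x y z : 1 < k ->
  ladder_rel k d both x y -> ladder_rel k d both y z ->
  ~~ ladder_rel k d both x z.
Proof.
case: x y z => [x a] [y b] [z c] k_gt1; rewrite /ladder_rel /half_ladder /=.
case: d both a b c => [] [] [] [] [] /=; lia.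
Qed.

(** * Zigzag walks *)

(* Only one vertex is visited in the columns belonging to [S]. *)
Fixpoint zigzag (S : pred nat) (i : nat) (s : bool) (c : nat) :=
  if c is c'.+1 then
    (i, s) :: (if S i then zigzag S i.+1 s c'
               else (i, ~~ s) :: zigzag S i.+1 (~~ s) c')
  else [::].

Lemma size_zigzag S i s c :
  size (zigzag S i s c) = c + count (predC S) (iota i c).
Proof.
elim: c i s => //= c IH i s.
by case: (S i); rewrite /= IH; lia.
Qed.

(** The row flips exactly in the columns outside [S], so only the parity of their number matters. *)
Lemma last_zigzag S i s c x :
  last x (zigzag S i s c.+1)
    = (i + c, s (+) odd (count (predC S) (iota i c.+1))).
Proof.
elim: c i s x => [|c IH] i s x.
  by rewrite /= !addn0; case: (S i); case: s.
have -> : count (predC S) (iota i c.+2)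
    = ~~ S i + count (predC S) (iota i.+1 c.+1) by [].
have -> : last x (zigzag S i s c.+2)
    = last (i, s) (if S i then zigzag S i.+1 s c.+1
                   else (i, ~~ s) :: zigzag S i.+1 (~~ s) c.+1) by [].
case: ifP => _; first by rewrite IH addSnnS.
rewrite last_cons IH addSnnS.
by rewrite oddD /=; case: s; case: (odd _).
Qed.

Lemma path_zigzag k d both S i s c x :
  ladder_rel k d both x (i, s) ->
  path (ladder_rel k d both) x (zigzag S i s c).
Proof.
elim: c i s x => //= c IH i s x -> /=.
case: (S i); first by apply/IH/ladder_rail.
by rewrite /= ladder_rung; apply/IH/ladder_rail.
Qed.

(** In a column of [S] this determines the one visited row, and thereby shows which vertex the walk
    misses. *)
Lemma mem_zigzag S i s c j b : (j, b) \in zigzag S i s c ->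
  i <= j < i + c /\
  (S j -> b = s (+) odd (count (predC S) (iota i (j - i)))).
Proof.
elim: c i s => //= c IH i s.
have later t : (j, b) \in zigzag S i.+1 t c -> i <= j < i + c.+1 /\
  (S j -> b = t (+) odd (count (predC S) (iota i.+1 (j - i.+1)))).
  by case/IH => ij bE; split=> //; lia.
have iotaS : i < j -> iota i (j - i) = i :: iota i.+1 (j - i.+1).
  by move=> lt_ij; rewrite -(@ltn_predK 0 (j - i)) ?subn_gt0 //= subnS.
rewrite inE => /orP[/eqP[-> ->]|].
  by rewrite subnn addbF; split=> //; lia.
case Si: (S i).
  move=> jb; case: (IH _ _ jb) => ij _; case: (later _ jb) => ? bE; split=> //.
  by move/bE ->; rewrite iotaS /= ?Si //; lia.
rewrite inE => /orP[/eqP[-> _]|]; first by rewrite Si; split=> //; lia.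
move=> jb; case: (IH _ _ jb) => ij _; case: (later _ jb) => ? bE; split=> //.
move/bE ->; rewrite iotaS /= ?Si; last by lia.
by rewrite oddD /= addNb addbN.
Qed.

Lemma zigzag_uniq S i s c : uniq (zigzag S i s c).
Proof.
elim: c i s => //= c IH i s.
have notin b t : (i, b) \notin zigzag S i.+1 t c.
  by apply/negP=> /mem_zigzag[]; lia.
case: (S i); first by rewrite notin IH.
by rewrite /= inE !negb_or !notin IH xpair_eqE eqxx; case: s.
Qed.

Lemma zigzag_cycle k d both S s :
  ladder_rel k d both
    (k.+1, s (+) odd (count (predC S) (iota 0 k.+2))) (0, s) ->
  cycle (ladder_rel k d both) (zigzag S 0 s k.+2).
Proof.
move=> close.
have := @last_zigzag S 0 s k.+1 (0, s); rewrite add0n.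
have := @path_zigzag k d both S 0 s k.+2 _ close.
have : head (0, s) (zigzag S 0 s k.+2) = (0, s) by [].
case: (zigzag S 0 s k.+2) => // y p /= -> /andP[_ pp] lp.
by rewrite rcons_path pp lp.
Qed.

(** * Boundary cycles *)

(** The outer cycle of the [c] columns from [i] on: out along row [false], back along row [true]. *)
Fixpoint boundary (i c : nat) : seq (nat * bool) :=
  if c is c'.+1 then (i, false) :: rcons (boundary i.+1 c') (i, true)
  else [::].

Lemma size_boundary i c : size (boundary i c) = c.*2.
Proof. by elim: c i => //= c IH i; rewrite size_rcons IH. Qed.

Lemma mem_boundary i c j b : (j, b) \in boundary i c -> i <= j < i + c.
Proof.
elim: c i => //= c IH i; rewrite inE mem_rcons inE.
by case/or3P=> [/eqP[-> _]|/eqP[-> _]|/IH]; lia.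
Qed.

Lemma boundary_uniq i c : uniq (boundary i c).
Proof.
elim: c i => //= c IH i.
rewrite mem_rcons inE rcons_uniq IH andbT.
rewrite !xpair_eqE andbF /=.
by apply/andP; split; apply/negP=> /mem_boundary; lia.
Qed.

Lemma path_boundary k d both i c x y :
  ladder_rel k d both x (i, false) -> ladder_rel k d both (i, true) y ->
  path (ladder_rel k d both) x (rcons (boundary i c.+1) y).
Proof.
elim: c i x y => [|c IH] i x y xi iy.
  by rewrite /= xi iy ladder_rung.
have -> : boundary i c.+2
    = (i, false) :: rcons (boundary i.+1 c.+1) (i, true) by [].
rewrite rcons_cons /= xi rcons_path last_rcons iy andbT.
by apply: IH; [|rewrite ladder_sym]; apply: ladder_rail.
Qed.

Lemma boundary_cycle k d both i c :
  cycle (ladder_rel k d both) (boundary i c.+2).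
Proof.
have -> : boundary i c.+2
    = (i, false) :: rcons (boundary i.+1 c.+1) (i, true) by [].
rewrite /cycle rcons_path last_rcons (ladder_rung _ _ _ _ true) andbT.
by apply: path_boundary; [|rewrite ladder_sym]; apply: ladder_rail.
Qed.

(** * Cycles of the required length avoiding a given vertex *)

Lemma count_predC_pred1 i c j :
  count (predC (pred1 j)) (iota i c) = c - (i <= j < i + c).
Proof.
have := count_predC (pred1 j) (iota i c).
by rewrite size_iota (count_uniq_mem _ (iota_uniq i c)) mem_iota; lia.
Qed.

Lemma count_predC_pred2 i c j j' : j != j' ->
  count (predC (pred2 j j')) (iota i c)
    = c - (i <= j < i + c) - (i <= j' < i + c).
Proof.
move=> neq_jj'.
have := count_predC (pred2 j j') (iota i c).
have := count_predUI (pred1 j) (pred1 j') (iota i c).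
rewrite (@eq_count _ (predI _ _) pred0) => [|l /=]; last by lia.
rewrite count_pred0 !(count_uniq_mem _ (iota_uniq i c)) !mem_iota size_iota.
rewrite (@eq_count _ (predU _ _) (pred2 j j')) => [|l //].
by lia.
Qed.

Definition ladder_cycle_avoiding k d both n (v : nat * bool) : Prop :=
  exists s, [/\ size s = n, uniq s, cycle (ladder_rel k d both) s,
    all (fun x => x.1 < k.+2) s & v \notin s].

Lemma odd_ladder_avoid k i (b : bool) :
  i < k.+2 ->
  ladder_cycle_avoiding k (odd k.+1) true (k.*2 + 3) (i, b).
Proof.
(* The row flips [i] times before column [i], so from this start the walk visits [(i, ~~ b)] there.
   In all it flips [k.+1] times, which matches the twist of the closing edges. *)
move=> lt_i; exists (zigzag (pred1 i) 0 (b (+) ~~ odd i) k.+2); split.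
- by rewrite size_zigzag count_predC_pred1; lia.
- exact: zigzag_uniq.
- apply: zigzag_cycle; rewrite count_predC_pred1 add0n /= lt_i subn1 /=.
  by rewrite /ladder_rel /half_ladder /= !eqxx ?orbT.
- by apply/allP=> -[j c] /mem_zigzag[/andP[]].
- apply/negP=> /mem_zigzag[_ /=]; rewrite eqxx => /(_ isT).
  rewrite count_predC_pred1 /= add0n subn0 ltnn subn0.
  by case: b; case: (odd i).
Qed.

Lemma even_ladder_avoid k i (b : bool) :
  0 < k -> i < k.+2 ->
  ladder_cycle_avoiding k (odd k) false (k.*2 + 2) (i, b).
Proof.
move=> k_gt0 lt_i.
(* Shortening columns [j] and [j'] leaves [k] flips, the twist of the closing edge, which forces the
   start in row [true]. The term [(j < i)] accounts for the flip lost when the other shortened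
   column precedes [i]. *)
have zz j j' : j < j' < k.+2 -> (i == j) || (i == j') ->
    b != true (+) odd (i - (j < i)) ->
  ladder_cycle_avoiding k (odd k) false (k.*2 + 2) (i, b).
  move=> /andP[lt_jj' lt_j'] ijj' bi; have neq_jj' : j != j' by lia.
  exists (zigzag (pred2 j j') 0 true k.+2); split.
  - by rewrite size_zigzag count_predC_pred2 //; lia.
  - exact: zigzag_uniq.
  - apply: zigzag_cycle; rewrite count_predC_pred2 //.
    have -> : k.+2 - (0 <= j < 0 + k.+2) - (0 <= j' < 0 + k.+2) = k by lia.
    by rewrite /ladder_rel /half_ladder /= !eqxx !orbT.
  - by apply/allP=> -[l c] /mem_zigzag[/andP[]].
  - apply/negP=> /mem_zigzag[_ /(_ ijj') bE]; case/eqP: bi; rewrite bE.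
    congr (_ (+) odd _); rewrite count_predC_pred2 //; lia.
(* The boundary of all columns but the last ([j = 0]) or the first ([j = 1]). *)
have bd j : (j == 0) || (j == 1) -> ~~ (j <= i < j + k.+1) ->
  ladder_cycle_avoiding k (odd k) false (k.*2 + 2) (i, b).
  move=> j01 ij; exists (boundary j k.+1); split.
  - by rewrite size_boundary; lia.
  - exact: boundary_uniq.
  - by case: (k) k_gt0 => // k' _; apply: boundary_cycle.
  - by apply/allP=> -[l c] /mem_boundary /=; lia.
  - by apply: contra ij => /mem_boundary.
(* Column [i] is paired with the last column if [b = odd i], and with the first otherwise, to get
   the right parity. This fails only at [(k.+1, odd k.+1)] and [(0, true)], the ends of the closing
   edge, where [bd] applies. *)
have [bi|bi] := eqVneq b (odd i).
  have [le_ik|lt_ki] := leqP i k; last by apply: (bd 0); lia.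
  apply: (zz i k.+1); rewrite ?eqxx ?ltnn ?subn0 //; first by lia.
  by rewrite bi; case: (odd i).
have [i0|i_gt0] := posnP i; first by apply: (bd 1); lia.
apply: (zz 0 i); rewrite ?eqxx ?orbT //; first by lia.
rewrite i_gt0 oddB // addTb negb_eqb; move: bi.
by case: (b); case: (odd i).
Qed.

(** * The ladder as a finite graph *)

Section LadderGraph.
Variables (k : nat) (d both : bool).

Definition ladder_coord (x : 'I_k.+2 * bool) : nat * bool := (val x.1, x.2).

Lemma ladder_graph_sym : symmetric (relpre ladder_coord (ladder_rel k d both)).
Proof. by move=> x y; apply: ladder_sym. Qed.

Lemma ladder_graph_irrefl :
  irreflexive (relpre ladder_coord (ladder_rel k d both)).
Proof. by move=> x; apply: ladder_irrefl. Qed.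

Definition ladder_graph : sgraph :=
  SGraph ladder_graph_sym ladder_graph_irrefl.

Lemma ladder_graph_cycle (s : seq (nat * bool)) (v : ladder_graph) :
  uniq s -> cycle (ladder_rel k d both) s -> all (fun x => x.1 < k.+2) s ->
  ladder_coord v \notin s ->
  exists s' : seq ladder_graph,
    [/\ size s' = size s, uniq s', cycle (@adj ladder_graph) s' & v \notin s'].
Proof.
move=> us cs bs vs.
(* [inord] would send columns out of range to [0]; [bs] excludes them. *)
pose lift (x : nat * bool) : ladder_graph := (inord x.1, x.2).
have liftK : map ladder_coord (map lift s) = s.
  rewrite -map_comp map_id_in // => -[i b] /(allP bs) /= lt_i.
  by rewrite /ladder_coord /= inordK.
exists (map lift s); split; first by rewrite size_map.
- by apply: (@map_uniq _ _ ladder_coord); rewrite liftK.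
- by move: cs; rewrite -{1}liftK cycle_map.
- by apply: contra vs => /(map_f ladder_coord); rewrite liftK.
Qed.

Lemma ladder_graph_connected : connected ladder_graph.
Proof.
split; first by apply/card_gt0P; exists (ord0, false).
have symc : connect_sym (@adj ladder_graph).
  exact/sym_connect_sym/adj_sym.
suff orig (x : ladder_graph) : connect (@adj ladder_graph) (ord0, false) x.
  by move=> x y; apply: connect_trans (orig y); rewrite symc.
case: x => i b.
suff row : connect (@adj ladder_graph) (ord0, false) (i, false).
  case: b => //; apply: connect_trans row (connect1 _).
  exact: (ladder_rung k d both i false).
case: i; elim=> [|i IH] lt_i.
  by apply: eq_connect0; congr (_, _); apply: val_inj.
apply: connect_trans (IH (ltnW lt_i)) (connect1 _).
exact: (ladder_rail k d both i false).
Qed.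

(** There are [k.+2] rungs, [k.+1] rails in each row and [1 + both] closing edges. For an upper
    bound it is enough that the list [E] covers all edges. *)
Lemma ladder_graph_size : gsize ladder_graph <= 3 * k + 5 + both.
Proof.
pose vtx (x : nat * bool) : ladder_graph := (inord x.1, x.2).
have vtxE (x : ladder_graph) : x = vtx (ladder_coord x).
  by case: x => i b; rewrite /vtx /ladder_coord /= inord_val.
pose E := [seq ((i, false), (i, true)) | i <- iota 0 k.+2] ++
  [seq ((i, false), (i.+1, false)) | i <- iota 0 k.+1] ++
  [seq ((i, true), (i.+1, true)) | i <- iota 0 k.+1] ++
  ((0, true), (k.+1, ~~ d)) :: nseq both ((0, false), (k.+1, d)).
have -> : 3 * k + 5 + both = size [seq [set vtx e.1; vtx e.2] | e <- E].
  by rewrite size_map !size_cat /= !size_map size_nseq !size_iota; lia.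
apply: leq_trans (card_size _); apply: subset_leq_card; apply/subsetP=> e.
have halfE (x y : ladder_graph) :
    half_ladder k d both (ladder_coord x) (ladder_coord y) ->
    [set x; y] \in [seq [set vtx e.1; vtx e.2] | e <- E].
  move=> h; apply/mapP; exists (ladder_coord x, ladder_coord y); last first.
    by rewrite -!vtxE.
  move: h; case: x y => [x a] [y b]; rewrite /half_ladder /ladder_coord /=.
  have lt_x := ltn_ord x; have lt_y := ltn_ord y.
  rewrite !mem_cat.
  case/or3P=> [/and3P[/eqP <- /negPf-> ->]|/andP[/eqP xy /eqP <-]|].
  - by apply/orP; left; apply/mapP; exists (val x); rewrite // mem_iota.
  - have x_iota : nat_of_ord x \in iota 0 k.+1 by rewrite mem_iota; lia.
    rewrite -xy; apply/orP; right; apply/orP.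
    case: a; last by left; apply/mapP; exists (val x).
    by right; apply/orP; left; apply/mapP; exists (val x).
  - case/and4P=> /eqP-> /eqP-> /eqP-> ab; do 3!(apply/orP; right).
    rewrite in_cons mem_nseq; move: ab.
    case: a => /= [_|]; first by rewrite eqxx.
    by rewrite orbF => ->; rewrite eqxx.
case/imsetP=> -[x y] xy ->; move: xy; rewrite inE => xy.
have /orP[|yx] : ladder_rel k d both (ladder_coord x) (ladder_coord y) := xy.
  exact: halfE.
by rewrite setUC; apply: halfE yx.
Qed.

End LadderGraph.

(** * The bounds for odd and even cycles *)

Lemma ladder_graph_witness n k d both : 1 < k -> 0 < n ->
  (forall i b, i < k.+2 -> ladder_cycle_avoiding k d both n (i, b)) ->
  exists r, is_conn_size_ramsey (copies 2 (complete_graph 2)) (cycle_graph n) r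
    /\ r <= 3 * k + 5 + both.
Proof.
move=> k_gt1 n_gt0 avoid.
have cF := ladder_graph_connected k d both.
have [|r [rP le_r]] := conn_size_ramsey_le cF (G := copies 2 (complete_graph 2))
  (H := cycle_graph n).
  apply: arrows_2K2_cycle n_gt0 _ _ => [|x y z|v]; first by case: cF.
    exact: ladder_triangle_free.
  have [s [<- us cs bs vs]] := avoid _ v.2 (ltn_ord v.1).
  exact: ladder_graph_cycle us cs bs vs.
by exists r; split=> //; apply: leq_trans le_r (ladder_graph_size k d both).
Qed.

Theorem theorem5p1 (n : nat) (hn : 6 <= n) :
  exists r : nat,
    is_conn_size_ramsey (copies 2 (complete_graph 2)) (cycle_graph n) r /\
    r <= (if odd n then (3 * n + 7) %/ 2 else (3 * n + 4) %/ 2).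
Proof.
case: ifPn => odd_n.
  pose k := (n - 3)./2; have nE : n = k.*2 + 3 by rewrite /k; lia.
  have [||i b|r [rP le_r]] := @ladder_graph_witness n k (odd k.+1) true;
    [lia|lia|rewrite nE; exact: odd_ladder_avoid|].
  (* With [n = 2k + 3] the ladder has at most [3k + 6] edges, while the bound is [3k + 8]. *)
  by exists r; split=> //; lia.
pose k := (n - 2)./2; have nE : n = k.*2 + 2 by rewrite /k; lia.
have [||i b|r [rP le_r]] := @ladder_graph_witness n k (odd k) false;
  [lia|lia|rewrite nE; apply: even_ladder_avoid; lia|].
(* With [n = 2k + 2] the bound is exactly [3k + 5]. *)
by exists r; split=> //; lia.
Qed.
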